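(* Let $G$ be a countable discrete group and $H \leq G$ a subgroup. If the left multiplication action $\alpha: G \curvearrowright G/H$ is sofic, then there exists a normal subgroup $N \trianglelefteq G$ such that $N \leq H$ and $G/N$ is sofic. In particular, if the left multiplication action $\alpha: G \curvearrowright G$ is sofic, then $G$ is sofic.
   Context: For a nonempty finite set $A$, $\mathrm{Sym}(A)$ is the group of permutations of $A$, with the normalized Hamming distance $d(\sigma,\tau) = |\{a \in A : \sigma(a) \neq \tau(a)\}|/|A|$. Let $\Gamma$ be a countable discrete group, $A$ a finite set, and $\varphi: \Gamma \to \mathrm{Sym}(A)$ a map (not necessarily a homomorphism). $\varphi$ is unital if $\varphi(1_\Gamma) = 1$. For finite $F \subseteq \Gamma$ and $\epsilon > 0$, $\varphi$ is $(F,\epsilon)$-multiplicative if $d(\varphi(gh), \varphi(g)\varphi(h)) < \epsilon$ for all $g,h \in F$. A countable discrete group $\Gamma$ is sofic if for all finite $F \subseteq \Gamma$ and $\epsilon > 0$ there exist a finite set $A$ and a map $\varphi: \Gamma \to \mathrm{Sym}(A)$ which is unital, $(F,\epsilon)$-multiplicative, and satisfies $d(1,\varphi(g)) > 1-\epsilon$ for all $g \in F \setminus \{1_\Gamma\}$. Let $\alpha: \Gamma \curvearrowright X$ be an action of a countable discrete group on a countable discrete set. For finite $F \subseteq \Gamma$, finite $E \subseteq X$ and $\epsilon > 0$, a map $\varphi: \Gamma \to \mathrm{Sym}(A)$ is an $(F,E,\epsilon)$-orbit approximation of $\alpha$ if there exist a finite set $B$ and a subset $S \subseteq A$ with $|S|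 > (1-\epsilon)|A|$ and, for each $s \in S$, an injective map $\pi_s: E \hookrightarrow B$, such that $\pi_{\varphi(g)s}(x) = \pi_s(\alpha(g^{-1})x)$ for all $s \in S$, $g \in F$, $x \in E$ whenever $\varphi(g)s \in S$ and $\alpha(g^{-1})x \in E$. The action $\alpha$ is sofic if for all finite $F \subseteq \Gamma$, finite $E \subseteq X$ and $\epsilon > 0$ there exist a finite set $A$ and a map $\varphi: \Gamma \to \mathrm{Sym}(A)$ which is unital, $(F,\epsilon)$-multiplicative, and an $(F,E,\epsilon)$-orbit approximation of $\alpha$. $G/H$ denotes the set of left cosets, and the left multiplication action is $\alpha(g)(kH) = gkH$. *)

(* Defs.v *)
From HB Require Import structures.
From mathcomp Require Import all_boot order ssralg ssrnum perm.
From mathcomp Require Import finmap reals.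

Set Implicit Arguments.
Unset Strict Implicit.
Unset Printing Implicit Defensive.

Local Open Scope group_scope.

(* The definitions use choiceType and countType carriers and boolean
   predicates.  With the classical axioms that come with [realType]
   (mathcomp.classical.boolp), every Prop-valued subset is such a predicate,
   and every type with an injection into nat is such a carrier.               *)

#[short(type="countGroupType")]
HB.structure Definition CountGroup := {G of Group G & Countable G}.

HB.mixin Record isConjClosed (G : groupType) (S : {pred G}) := {
  gpredJr : forall x y : G, x \in S -> x ^ y \in S
}.

#[short(type="normalGroupClosed")]
HB.structure Definition NormalGroupClosed (G : groupType) :=
  {S of GroupClosed G S & isConjClosed G S}.

Section LeftCosets.
Variables (G : countGroupType) (H : groupClosed G).

Definition lcoset_rel : rel G := fun x y => x^-1 * y \in H.

Lemma lcoset_rel_refl : reflexive lcoset_rel.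
Proof. by move=> x; rewrite /lcoset_rel mulVg gpred1. Qed.

Lemma lcoset_rel_sym : symmetric lcoset_rel.
Proof. by move=> x y; rewrite /lcoset_rel -gpredV invgM invgK. Qed.

Lemma lcoset_rel_trans : transitive lcoset_rel.
Proof.
move=> y x z Hxy Hyz; rewrite /lcoset_rel.
by have := gpredM _ _ Hxy Hyz; rewrite mulgA mulgK.
Qed.

Canonical lcoset_equiv :=
  EquivRel lcoset_rel lcoset_rel_refl lcoset_rel_sym lcoset_rel_trans.

(* x and y have the same class iff x^-1 * y \in H, i.e. iff xH = yH: the class
   \pi k stands for the left coset kH.                                        *)
Definition lcosets := {eq_quot lcoset_equiv}%qT.

HB.instance Definition _ := Countable.on lcosets.
HB.instance Definition _ := EqQuotient.on lcosets.

End LeftCosets.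


Section QuotientGroup.
Variables (G : countGroupType) (N : normalGroupClosed G).
Local Open Scope quotient_scope.
Local Notation Q := (lcosets N).

Definition quotg_one : Q := \pi_Q 1.
Definition quotg_inv (a : Q) : Q := \pi_Q ((repr a)^-1).
Definition quotg_mul (a b : Q) : Q := \pi_Q (repr a * repr b).

Lemma quotgP (x y : G) : reflect (\pi_Q x = \pi_Q y) (x^-1 * y \in N).
Proof. exact: (@eqquotP _ _ Q x y). Qed.

Lemma quotg_invE (x : G) : quotg_inv (\pi_Q x) = \pi_Q (x^-1).
Proof.
apply/quotgP; rewrite invgK.
have /quotgP h : \pi_Q (repr (\pi_Q x)) = \pi_Q x by rewrite reprK.
rewrite -gpredV invgM invgK.
by have := gpredJr _ x^-1 h; rewrite /conjg invgK !mulgA mulgK.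
Qed.

Lemma quotg_mulE (x y : G) : quotg_mul (\pi_Q x) (\pi_Q y) = \pi_Q (x * y).
Proof.
apply/quotgP.
set x' := repr _; set y' := repr _.
have /quotgP hx : \pi_Q x' = \pi_Q x by rewrite reprK.
have /quotgP hy : \pi_Q y' = \pi_Q y by rewrite reprK.
have := gpredM _ _ (gpredJr _ y' hx) hy.
by rewrite /conjg invgM !mulgA mulgK.
Qed.

Lemma quotg_mulA : associative quotg_mul.
Proof.
move=> a b c; rewrite -[a]reprK -[b]reprK -[c]reprK.
move: (repr a) (repr b) (repr c) => x y z.
by rewrite (quotg_mulE y z) (quotg_mulE x y) !quotg_mulE mulgA.
Qed.

Lemma quotg_mul1 : left_id quotg_one quotg_mul.
Proof. by move=> a; rewrite -[a]reprK quotg_mulE mul1g. Qed.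

Lemma quotg_1mul : right_id quotg_one quotg_mul.
Proof. by move=> a; rewrite -[a]reprK quotg_mulE mulg1. Qed.

Lemma quotg_mulV : left_inverse quotg_one quotg_inv quotg_mul.
Proof. by move=> a; rewrite -[a]reprK quotg_invE quotg_mulE mulVg. Qed.

Lemma quotg_Vmul : right_inverse quotg_one quotg_inv quotg_mul.
Proof. by move=> a; rewrite -[a]reprK quotg_invE quotg_mulE mulgV. Qed.

HB.instance Definition _ := isGroup.Build Q
  quotg_mulA quotg_mul1 quotg_1mul quotg_mulV quotg_Vmul.

End QuotientGroup.

(* [action] in mathcomp.fingroup is a right action of a finite group. *)
Structure left_action (G : groupType) (X : Type) := LeftAction {
  lact :> G -> X -> X;
  lact1 : forall x, lact 1 x = x;
  lactM : forall g h x, lact (g * h) x = lact g (lact h x)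
}.

Section TranslationActions.
Variable G : countGroupType.

Definition ltrans_action : left_action G G :=
  LeftAction (lact := fun g x => g * x) (@mul1g G)
    (fun g h x => esym (mulgA g h x)).

Variable H : groupClosed G.
Local Open Scope quotient_scope.
Local Notation Q := (lcosets H).

Definition lcoset_act (g : G) (c : Q) : Q := \pi_Q (g * repr c).

Lemma lcoset_actE (g k : G) : lcoset_act g (\pi_Q k) = \pi_Q (g * k).
Proof.
have /(@eqquotP _ _ Q) h : \pi_Q (repr (\pi_Q k)) = \pi_Q k by rewrite reprK.
by apply/(@eqquotP _ _ Q); rewrite /= /lcoset_rel invgM !mulgA mulgVK.
Qed.

Lemma lcoset_act1 (c : Q) : lcoset_act 1 c = c.
Proof. by rewrite -[c]reprK lcoset_actE mul1g. Qed.

Lemma lcoset_actM (g h : G) (c : Q) :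
  lcoset_act (g * h) c = lcoset_act g (lcoset_act h c).
Proof.
rewrite -[c]reprK; move: (repr c) => k.
by rewrite (lcoset_actE h k) !lcoset_actE mulgA.
Qed.

Definition lcoset_action : left_action G Q :=
  LeftAction lcoset_act1 lcoset_actM.

End TranslationActions.

Section Sofic.
Variable R : realType.
Local Open Scope ring_scope.

Definition hamming (A : finType) (s t : {perm A}) : R :=
  #|[set a | s a != t a]|%:R / #|A|%:R.

Section Maps.
Variables (G : countGroupType) (A : finType) (phi : G -> {perm A}).

Definition unital := phi 1%g = 1%g.

(* The product s * t of {perm A} is "s, then t"; the composite
   phi(g) phi(h) of maps is therefore phi h * phi g.                          *)
Definition multiplicative_upto (F : {fset G}) (eps : R) :=
  forall g h, g \in F -> h \in F ->
    hamming (phi (g * h)%g) (phi h * phi g)%g < eps.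

(* pi s stands for an injection of E into B for each s in S: its values for s
   outside S, and outside E, are junk.                                        *)
Definition orbit_approx (X : countType) (alpha : left_action G X)
    (F : {fset G}) (E : {fset X}) (eps : R) :=
  exists (B : finType) (S : {set A}) (pi : A -> X -> B),
    [/\ (1 - eps) * #|A|%:R < #|S|%:R,
        forall s, s \in S -> {in E &, injective (pi s)}
      & forall s g x, s \in S -> g \in F -> x \in E ->
          phi g s \in S -> alpha g^-1%g x \in E ->
          pi (phi g s) x = pi s (alpha g^-1%g x)].

End Maps.

Definition sofic_group (G : countGroupType) :=
  forall (F : {fset G}) (eps : R), 0 < eps ->
  exists (A : finType) (phi : G -> {perm A}),
    [/\ (0 < #|A|)%N, unital phi, multiplicative_upto phi F eps
      & forall g, g \in F -> g != 1%g -> 1 - eps < hamming 1%g (phi g)].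

Definition sofic_action (G : countGroupType) (X : countType)
    (alpha : left_action G X) :=
  forall (F : {fset G}) (E : {fset X}) (eps : R), 0 < eps ->
  exists (A : finType) (phi : G -> {perm A}),
    [/\ (0 < #|A|)%N, unital phi, multiplicative_upto phi F eps
      & orbit_approx phi alpha F E eps].

End Sofic.

(* Main.v *)
(** For [x] in the set acted on, an orbit approximation [phi] of the action must
    move almost every point by [phi g] as soon as [g x <> x].  For the translation
    action of [G] on itself this is soficity of [G].  For [G/H] and [x = H] it says
    that the lengths [hamming 1 (phi g)] are near 1 for [g] outside [H].  By
    Tychonoff these functions on [G] have a pointwise limit [l] along better and
    better approximations; [l] is a conjugation-invariant length function, so
    [N = {l = 0}] is a normal subgroup contained in [H].  The maps [phi] induce
    approximate homomorphisms of [G/N] in which a nontrivial element has length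
    bounded below, and passing to the diagonal action on a power [A^k] brings this
    length close to 1. *)

Require Import Defs.
From HB Require Import structures.
From mathcomp Require Import classical_sets filter topology normedtype.
From mathcomp Require Import sequences ring lra.
From mathcomp Require Import all_boot order ssralg ssrnum perm.
From mathcomp Require Import finmap reals interval.

Set Implicit Arguments.
Unset Strict Implicit.
Unset Printing Implicit Defensive.

Import Order.TTheory GRing.Theory Num.Theory.
Import numFieldNormedType.Exports.
Local Open Scope ring_scope.

(** * The normalized Hamming distance as a bi-invariant metric *)

Section HammingDistance.
Variables (R : realType) (A : finType).
Implicit Types s t u : {perm A}.
Local Notation d := (@hamming R A).

Lemma hamming_ge0 s t : 0 <= d s t.
Proof. by rewrite /hamming divr_ge0. Qed.

Lemma hamming_le1 s t : d s t <= 1.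
Proof.
rewrite /hamming; have [->|A0] := eqVneq #|A| 0%N; first by rewrite invr0 mulr0.
by rewrite ler_pdivrMr ?ltr0n ?lt0n // mul1r ler_nat max_card.
Qed.

Lemma hammingxx s : d s s = 0.
Proof.
rewrite /hamming (_ : [set a | _] = set0)%SET ?cards0 ?mul0r //.
by apply/setP => a; rewrite !inE eqxx.
Qed.

Lemma hammingC s t : d s t = d t s.
Proof.
rewrite /hamming; congr (#|pred_of_set _|%:R / _).
by apply/setP => a; rewrite !inE eq_sym.
Qed.

Lemma hamming_triangle t s u : d s u <= d s t + d t u.
Proof.
rewrite /hamming -mulrDl ler_wpM2r ?invr_ge0 // -natrD ler_nat.
apply: leq_trans (leq_card_setU _ _); apply/subset_leq_card/fintype.subsetP => a.
by rewrite !inE; case: (eqVneq (s a) (t a)) => [->|].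
Qed.

Lemma hamming_mull u s t : d (u * s)%g (u * t)%g = d s t.
Proof.
rewrite /hamming; congr (_%:R / _).
rewrite -(card_imset _ (@perm_inj _ u)); congr #|pred_of_set _|.
apply/setP => a; rewrite inE; apply/imsetP/idP => [[b +] ->|sta].
  by rewrite inE !permM.
by exists (u^-1%g a); rewrite ?inE ?permM permKV.
Qed.

Lemma hamming_mulr u s t : d (s * u)%g (t * u)%g = d s t.
Proof.
rewrite /hamming; congr (#|pred_of_set _|%:R / _).
by apply/setP => a; rewrite !inE !permM (inj_eq perm_inj).
Qed.

(** Agreement sets, unlike disagreement sets, become products in powers of [A], so powers are
    handled through this complement. *)
Lemma card_agree s t : (0 < #|A|)%N ->
  #|[set a | s a == t a]|%:R = (1 - d s t) * #|A|%:R.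
Proof.
move=> A0; have A0' : #|A|%:R != 0 :> R by rewrite pnatr_eq0 -lt0n.
rewrite mulrBl mul1r /hamming mulfVK // -(cardsC [set a | s a == t a]) natrD.
rewrite (_ : ~: _ = [set a | s a != t a])%SET ?addrK //.
by apply/setP => a; rewrite !inE.
Qed.

End HammingDistance.

(** * Diagonal action on powers: amplification of lengths *)

Section TensorPower.
Variables (R : realType) (A : finType) (k : nat).
Implicit Types s t : {perm A}.

Let pow_fun s (f : {ffun 'I_k -> A}) := [ffun i => s (f i)].

Lemma pow_fun_inj s : injective (pow_fun s).
Proof.
move=> f g /ffunP efg; apply/ffunP => i.
by have := efg i; rewrite !ffunE => /perm_inj.
Qed.

Definition perm_pow s : {perm {ffun 'I_k -> A}} := perm (@pow_fun_inj s).

Lemma perm_powE s f i : perm_pow s f i = s (f i).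
Proof. by rewrite permE ffunE. Qed.

Lemma perm_pow1 : perm_pow 1 = 1%g.
Proof. by apply/permP => f; apply/ffunP => i; rewrite perm_powE !perm1. Qed.

Lemma perm_powM s t : perm_pow (s * t)%g = (perm_pow s * perm_pow t)%g.
Proof. by apply/permP => f; apply/ffunP => i; rewrite permM !perm_powE permM. Qed.

(** Two diagonal permutations agree at a tuple exactly when [s] and [t] agree at each coordinate, so
    the proportion of agreement is raised to the power [k]. *)
Lemma hamming_perm_pow s t : (0 < #|A|)%N ->
  hamming R (perm_pow s) (perm_pow t) = 1 - (1 - hamming R s t) ^+ k.
Proof.
move=> A0.
have P0 : (0 < #|{ffun 'I_k -> A}|)%N by rewrite card_ffun card_ord expn_gt0 A0.
have A0' : #|{ffun 'I_k -> A}|%:R != 0 :> R by rewrite pnatr_eq0 -lt0n.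
suff e : 1 - hamming R (perm_pow s) (perm_pow t) = (1 - hamming R s t) ^+ k.
  by rewrite -e; ring.
apply: (mulIf A0'); rewrite -card_agree //.
rewrite card_ffun card_ord natrX -exprMn -card_agree // -natrX.
congr _%:R; rewrite -[in RHS](card_ord k) -card_ffun_on; apply: eq_card => f.
rewrite inE; apply/eqP/ffun_onP => [/ffunP e i|e].
  by rewrite inE -!perm_powE e.
by apply/ffunP => i; have := e i; rewrite !perm_powE inE => /eqP.
Qed.

(** Bernoulli's inequality; it bounds the growth of multiplicativity errors under amplification. *)
Lemma le_hamming_perm_pow s t : (0 < #|A|)%N ->
  hamming R (perm_pow s) (perm_pow t) <= k%:R * hamming R s t.
Proof.
move=> A0; rewrite hamming_perm_pow //.
have h0 := hamming_ge0 R s t; have h1 := hamming_le1 R s t.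
move: (hamming R s t) h0 h1 => h h0 h1; elim: k => [|m IH].
  by rewrite expr0 subrr mul0r.
have p1 : (1 - h) ^+ m <= 1 by rewrite exprn_ile1 //; lra.
have p2 : h * (1 - h) ^+ m <= h * 1 by rewrite ler_wpM2l.
by rewrite exprS -natr1; lra.
Qed.

End TensorPower.

(** * Orbit approximations displace almost every point *)

Section DisplacedPoint.
Variables (R : realType) (G : countGroupType) (X : countType).
Variable alpha : left_action G X.

(* If phi g fixed a point s of S, then [pi s] would identify x with
   [alpha g^-1 x]; so phi g moves every s such that s and phi g s are in S. *)
Lemma orbit_approx_displace (A : finType) (phi : G -> {perm A})
    (F : {fset G}) (E : {fset X}) (eps : R) (g : G) (x : X) :
  orbit_approx phi alpha F E eps -> g \in F -> x \in E ->
  alpha g^-1%g x \in E -> alpha g^-1%g x <> x ->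
  1 - eps *+ 2 < hamming R 1%g (phi g).
Proof.
move=> [B [S [pi [cS injpi piE]]]] gF xE gxE gx.
have A0 : 0 < #|A|%:R :> R.
  rewrite ltr0n lt0n; apply/eqP => A0; move: cS.
  by rewrite A0 mulr0 ltr0n ltnNge -A0 max_card.
rewrite /hamming ltr_pdivlMr //.
pose T := (phi g @^-1: S)%SET.
have cT : #|T| = #|S| by exact: card_preimset (@perm_inj _ (phi g)).
have sub : (#|S :&: T| <= #|[set a | (1%g : {perm A}) a != phi g a]|)%N.
  apply/subset_leq_card/fintype.subsetP => a; rewrite !inE perm1 => /andP[aS gaS].
  apply/eqP => ea; apply: gx; apply: (injpi a) => //.
  by rewrite -piE // -ea.
(* Inclusion-exclusion: [S] and its preimage [T] each miss less than a proportion [eps] of [A],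
   hence the loss of [eps *+ 2]. *)
have cU : (#|S| + #|T| <= #|A| + #|S :&: T|)%N.
  by rewrite -cardsUI leq_add2r max_card.
have : #|S|%:R + #|T|%:R <=
    #|A|%:R + #|[set a | (1%g : {perm A}) a != phi g a]|%:R :> R.
  by rewrite -!natrD ler_nat (leq_trans cU) ?leq_add2l.
rewrite cT; lra.
Qed.

Lemma sofic_action_displace (x : X) (F : {fset G}) (eps : R) :
  sofic_action R alpha -> 0 < eps ->
  exists (A : finType) (phi : G -> {perm A}),
    [/\ (0 < #|A|)%N, unital phi, multiplicative_upto phi F eps
      & forall g, g \in F -> alpha g x <> x -> 1 - eps < hamming R 1%g (phi g)].
Proof.
move=> sof eps0; have eps20 : 0 < eps / 2 by lra.
(* [E] holds [x] and all the translates [alpha g^-1 x] whose labels are compared with that of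
   [x]. *)
pose E := (x |` [fset alpha g^-1%g x | g in F])%fset.
have [A [phi [A0 phi1 phiM phiE]]] := sof F E _ eps20.
exists A, phi; split=> //.
  by move=> g h gF hF; apply: lt_le_trans (phiM g h gF hF) _; lra.
move=> g gF gx; suff : 1 - (eps / 2) *+ 2 < hamming R 1%g (phi g) by lra.
apply: (orbit_approx_displace (x := x) phiE) => //.
- by rewrite !inE eqxx.
- by rewrite !inE; apply/orP; right; apply/imfsetP; exists g.
- by move=> e; apply: gx; rewrite -{1}e -lactM mulgV lact1.
Qed.

End DisplacedPoint.

(** * Compactness of the cube of functions with values in [0, 1] *)

Section PointwiseLimit.
Variables (R : realType) (T : countType).
Local Open Scope classical_set_scope.

(** The sets [B F eps] generate a proper filter on a compact cube, and any cluster point serves as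
    [l]. *)
Lemma finite_approx_limit (B : {fset T} -> R -> set (T -> R)) :
  (forall F eps, 0 < eps -> B F eps !=set0) ->
  (forall F eps f, B F eps f -> forall x, 0 <= f x <= 1) ->
  (forall F F' eps eps', {subset F <= F'} -> eps' <= eps ->
     B F' eps' `<=` B F eps) ->
  exists l : T -> R, forall F eps, 0 < eps ->
    exists2 f, B F eps f & forall x, x \in F -> `|f x - l x| < eps.
Proof.
move=> B0 B01 Bdec.
pose D := [set p : {fset T} * R | 0 < p.2].
pose U := filter_from D (fun p => B p.1 p.2).
have UF : ProperFilter U.
  apply: filter_from_proper => [|[F eps] /= eps0]; last exact: B0.
  apply: filter_from_filter => [|[F eps] [F' eps'] /= eps0 eps'0].
    by exists (fset0, 1); rewrite /D /= ltr01.
  exists ((F `|` F')%fset, Num.min eps eps'); rewrite /D /= ?lt_min ?eps0 //.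
  move=> f Bf; split; apply: Bdec Bf; rewrite ?ge_min ?lexx ?orbT //.
    by move=> x xF; rewrite inE xF.
  by move=> x xF; rewrite inE xF orbT.
pose I01 : set R := [set` `[0, 1]%R].
have cpt : compact [set f : prod_topology (fun=> R) | forall x : T, I01 (f x)].
  by apply: (@tychonoff T (fun=> R) (fun=> I01)) => x; exact: segment_compact.
have [|l [_ lU]] := cpt U UF.
  exists (fset0, 1); rewrite /D /= ?ltr01 // => f Bf x.
  by rewrite /I01 /= itv_boundlr; exact: B01 Bf x.
exists l => F eps eps0.
have /lU nb : U (B F eps) by exists (F, eps).
(* Closeness to [l] on the finite set [F] is a finite intersection of open cylinders, so this
   neighbourhood meets [B F eps]. *)
have : nbhs l (\bigcap_(x in [set` F])
    [set f : prod_topology (fun=> R) | `|f x - l x| < eps]).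
  apply: filter_bigI => x xF.
  have near_lx : nbhs (l x : R) [set y : R | `|y - l x| < eps].
    have := nbhsx_ballx (l x : R) _ eps0; apply: filterS => y.
    by rewrite -ball_normE /= distrC.
  exact: (@proj_continuous T (fun=> R) x l _ near_lx).
by move=> /nb[f [Bf fl]]; exists f.
Qed.

End PointwiseLimit.

(** Normalizing the section at the identity makes the maps induced on the quotient unital. *)
Lemma quotient_section (G : countGroupType) (N : normalGroupClosed G) :
  exists2 r : lcosets N -> G, r 1%g = 1%g & forall c, \pi_(lcosets N)%qT (r c) = c.
Proof.
exists (fun c : lcosets N => if c == 1%g then 1%g else repr c).
  by rewrite eqxx.
by move=> c; case: eqP => [->|_]; rewrite ?reprK.
Qed.

(** * The limit length function, its kernel, and soficity of the quotient *)

Section LimitLength.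
Variables (R : realType) (G : countGroupType) (l : G -> R).

(* l is a pointwise limit of the functions [g |-> hamming 1 (phi g)] along
   asymptotically multiplicative maps phi. *)
Hypothesis lP : forall (F : {fset G}) (eps : R), 0 < eps ->
  exists (A : finType) (phi : G -> {perm A}),
    [/\ (0 < #|A|)%N, unital phi, multiplicative_upto phi F eps
      & forall g, g \in F -> `|hamming R 1%g (phi g) - l g| < eps].

Lemma limit_length_ge0 g : 0 <= l g.
Proof.
apply/ler_addgt0Pr => e e0; have [A [phi [_ _ _ dl]]] := lP [fset g]%fset e0.
have := dl g (fset11 g); rewrite ltr_norml => /andP[_].
by have := hamming_ge0 R 1%g (phi g); lra.
Qed.

Lemma limit_length1 : l 1%g = 0.
Proof.
apply/le_anti; rewrite limit_length_ge0 andbT.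
apply/ler_addgt0Pr => e e0; have [A [phi [_ phi1 _ dl]]] := lP [fset 1%g]%fset e0.
have := dl 1%g (fset11 1%g); rewrite phi1 hammingxx ltr_norml => /andP[]; lra.
Qed.

(** Follows from bi-invariance and the triangle inequality; the quarters of [e] absorb one
    multiplicativity error and three limit errors. *)
Lemma limit_lengthM g h : l (g * h)%g <= l g + l h.
Proof.
apply/ler_addgt0Pr => e e0; have e40 : 0 < e / 4 by lra.
have [A [phi [_ _ phiM dl]]] := lP [fset g; h; (g * h)%g]%fset e40.
have := dl g; have := dl h; have := dl (g * h)%g; have := phiM g h.
rewrite !inE !eqxx ?orbT => /(_ isT isT) dM.
move=> /(_ isT) + /(_ isT) + /(_ isT); rewrite !ltr_norml.
move=> /andP[_ d1] /andP[_ d2] /andP[_ d3].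
have := dl g; have := dl h; have := dl (g * h)%g.
rewrite !inE !eqxx ?orbT !ltr_norml.
move=> /(_ isT)/andP[d4 _] /(_ isT)/andP[d5 _] /(_ isT)/andP[d6 _].
have t1 := hamming_triangle R (phi h * phi g)%g 1%g (phi (g * h)%g).
have t2 := hamming_triangle R (phi g) 1%g (phi h * phi g)%g.
have e1 := hamming_mulr R (phi g) 1%g (phi h); rewrite mul1g in e1.
rewrite hammingC in dM; lra.
Qed.

Lemma limit_lengthV g : l g^-1%g <= l g.
Proof.
apply/ler_addgt0Pr => e e0; have e40 : 0 < e / 4 by lra.
have [A [phi [_ phi1 phiM dl]]] := lP [fset g; g^-1%g]%fset e40.
have := dl g; have := dl g^-1%g; have := phiM g^-1%g g.
rewrite !inE !eqxx ?orbT mulVg phi1 => /(_ isT isT) dM.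
rewrite !ltr_norml => /(_ isT)/andP[d1 d2] /(_ isT)/andP[d3 d4].
have e1 := hamming_mull R (phi g) 1%g (phi g^-1%g); rewrite mulg1 in e1.
have t1 := hamming_triangle R 1%g (phi g) (phi g * phi g^-1%g)%g.
rewrite (hammingC R (phi g) 1%g) in t1; lra.
Qed.

(** [phi (x ^ y)] is close to a conjugate of [phi x], and conjugation preserves Hamming length.
    Three multiplicativity errors and two limit errors fit within [e]. *)
Lemma limit_lengthJ x y : l (x ^ y)%g <= l x.
Proof.
apply/ler_addgt0Pr => e e0; have e80 : 0 < e / 8 by lra.
have [A [phi [_ phi1 phiM dl]]] :=
  lP [fset x; y; y^-1%g; (x * y)%g; (x ^ y)%g]%fset e80.
have := dl x; have := dl (x ^ y)%g.
have := phiM x y; have := phiM y^-1%g (x * y)%g; have := phiM y^-1%g y.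
rewrite !inE !eqxx ?orbT mulVg phi1.
move=> /(_ isT isT) m1 /(_ isT isT) m2 /(_ isT isT) m3.
rewrite !ltr_norml => /(_ isT)/andP[d1 d2] /(_ isT)/andP[d3 d4].
rewrite -/(conjg x y) in m2.
rewrite -(hamming_mulr R (phi y^-1%g) (phi (x * y)%g)) in m3.
have e1 := hamming_mull R (phi y) 1%g (phi x); rewrite mulg1 in e1.
rewrite -(hamming_mulr R (phi y^-1%g)) in e1.
have t1 := hamming_triangle R (phi y * phi y^-1%g)%g 1%g (phi (x ^ y)%g).
have t2 := hamming_triangle R (phi y * phi x * phi y^-1%g)%g
  (phi y * phi y^-1%g)%g (phi (x ^ y)%g).
have t3 := hamming_triangle R (phi (x * y)%g * phi y^-1%g)%g
  (phi y * phi x * phi y^-1%g)%g (phi (x ^ y)%g).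
rewrite hammingC in m2; rewrite hammingC in m3; lra.
Qed.

Lemma limit_kernel :
  exists N : normalGroupClosed G, forall g, (g \in N) = (l g == 0).
Proof.
pose S : {pred G} := fun g => l g == 0.
(* Since [l] is nonnegative, one-sided bounds on [l] give all the closure properties. *)
have SE g : (g \in S) = (l g <= 0).
  by have -> : (g \in S) = (l g == 0) by []; rewrite eq_le limit_length_ge0 andbT.
have S1 : isMul1Closed G S by split; rewrite SE limit_length1.
have SM : isMulClosed G S.
  by split=> g h; rewrite !SE => g0 h0; have := limit_lengthM g h; lra.
have SV : isInvClosed G S.
  by split=> g; rewrite !SE; apply: le_trans (limit_lengthV g).
have SJ : isConjClosed G S.
  by split=> x y; rewrite !SE; apply: le_trans (limit_lengthJ x y).
by exists (HB.pack_for (normalGroupClosed G) S S1 SM SV SJ).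
Qed.


(** A finite set has a least nonzero length; the cap at 1 keeps [1 - delta / 2] in [0, 1) for the
    amplification. *)
Lemma limit_length_gap (s : seq G) :
  exists2 delta, 0 < delta <= 1 & forall g, g \in s -> l g != 0 -> delta <= l g.
Proof.
elim: s => [|h s [e /andP[e0 e1] le]]; first by exists 1; rewrite ?ltr01 ?lexx.
have [h0|h0] := eqVneq (l h) 0.
  exists e; rewrite ?e0 // => g; rewrite inE => /orP[/eqP->|gs]; last exact: le.
  by rewrite h0 eqxx.
have h_gt0 : 0 < l h by rewrite lt_neqAle eq_sym h0 limit_length_ge0.
exists (Num.min e (l h)); first by rewrite lt_min e0 h_gt0 ge_min e1.
move=> g; rewrite inE => /orP[/eqP-> _|gs g0]; first by rewrite ge_min lexx orbT.
by rewrite ge_min le.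
Qed.

Lemma limit_kernel_sofic (N : normalGroupClosed G) :
  (forall g, (g \in N) = (l g == 0)) -> sofic_group R (lcosets N).
Proof.
move=> NE F eps eps0.
have [r r1 rK] := quotient_section N.
(* [n c d] is the defect of [r] as a homomorphism. It lies in [N], so its limit length is 0 and
   [phi (n c d)] is nearly the identity. *)
pose n c d := ((r c * r d)^-1 * r (c * d))%g.
have nN c d : n c d \in N.
  by apply/quotgP; rewrite -quotg_mulE !rK.
have rn c d : (r c * r d * n c d = r (c * d))%g by rewrite mulVKg.
have rN c : c != 1%g -> r c \notin N.
  apply: contra => rcN; rewrite -[c]rK; apply/eqP.
  by apply/esym/quotgP; rewrite invg1 mul1g.
have [delta /andP[d0 d1] gap] := limit_length_gap [seq r c | c <- enum_fset F].
have [k kE] : exists k, (1 - delta / 2) ^+ k < eps.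
  have /cvgr0_norm_lt :
      ((GRing.exp (1 - delta / 2) : nat -> R) @ \oo --> (0 : R))%classic.
    by apply: cvg_expr; rewrite ger0_norm; lra.
  move=> /(_ _ eps0)/filter_ex[k kE]; exists k; apply: le_lt_trans kE.
  exact: ler_norm.
pose K := ([fset r c | c in F] `|` [fset (r c * r d)%g | c in F, d in F]
  `|` [fset n c d | c in F, d in F])%fset.
have k30 : 0 < 3 * (k%:R + 1) :> R by rewrite mulr_gt0 // ltr_wpDl.
(* The first bound keeps nontrivial lengths above [delta / 2]. In the second, 3 counts the errors in
   one product and [k] is the amplification factor; adding 1 covers [k = 0] and makes the final
   inequality strict. *)
pose eta := Num.min (delta / 2) (eps / (3 * (k%:R + 1))).
have eta0 : 0 < eta by rewrite lt_min !divr_gt0.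
have [A [phi [A0 phi1 phiM dl]]] := lP K eta0.
have rK1 c : c \in F -> r c \in K.
  by move=> cF; rewrite !inE in_imfset.
have rK2 c d : c \in F -> d \in F -> (r c * r d)%g \in K.
  move=> cF dF; rewrite !inE; apply/orP; left; apply/orP; right.
  exact: in_imfset2.
have rK3 c d : c \in F -> d \in F -> n c d \in K.
  by move=> cF dF; rewrite !inE; apply/orP; right; apply: in_imfset2.
exists _, (fun c => perm_pow k (phi (r c))); split.
- by rewrite card_ffun card_ord expn_gt0 A0.
- by rewrite /unital r1 phi1 perm_pow1.
- move=> c d cF dF; rewrite -perm_powM.
  apply: le_lt_trans (le_hamming_perm_pow _ _ _ _ A0) _.
  have m1 := phiM _ _ (rK1 c cF) (rK1 d dF).
  have m2 := phiM _ _ (rK2 c d cF dF) (rK3 c d cF dF).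
  rewrite rn in m2.
  have := dl _ (rK3 c d cF dF).
  have /eqP -> : l (n c d) == 0 by rewrite -NE nN.
  rewrite subr0 => /(le_lt_trans (ler_norm _)) m3.
  have e1 := hamming_mulr R (phi (r c * r d)%g) 1%g (phi (n c d)).
  rewrite mul1g hammingC in e1.
  have t1 := hamming_triangle R (phi (n c d) * phi (r c * r d))%g
    (phi (r (c * d)%g)) (phi (r d) * phi (r c))%g.
  have t2 := hamming_triangle R (phi (r c * r d)%g)
    (phi (n c d) * phi (r c * r d))%g (phi (r d) * phi (r c))%g.
  (* The three errors: splitting off [n c d], the length of [phi (n c d)], and the product of [r c]
     and [r d]. *)
  have hb : hamming R (phi (r (c * d)%g)) (phi (r d) * phi (r c))%g < eta * 3.
    lra.
  have etaE : eta * 3 * (k%:R + 1) <= eps.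
    by rewrite -mulrA -ler_pdivlMr // ge_min lexx orbT.
  have k0 : 0 <= k%:R :> R by [].
  have : k%:R * hamming R (phi (r (c * d)%g)) (phi (r d) * phi (r c))%g
      <= k%:R * (eta * 3) by rewrite ler_wpM2l // ltW.
  nra.
- move=> c cF c1; rewrite -(perm_pow1 A k) hamming_perm_pow //.
  have lc : delta <= l (r c).
    by apply: gap; [apply/map_f | rewrite -NE rN].
  have := dl _ (rK1 c cF); rewrite ltr_norml => /andP[+ _].
  have : eta <= delta / 2 by rewrite ge_min lexx.
  have := hamming_le1 R 1%g (phi (r c)).
  set h := hamming _ _ _ => h1 eta_d hl.
  rewrite ltrD2l ltrN2; apply: le_lt_trans kE.
  by rewrite lerXn2r // ?nnegrE; lra.
Qed.

End LimitLength.

(** * Assembly: the kernel of the limit length lies in [H] *)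

Theorem theorem2p12 (R : realType) (G : countGroupType) :
  (forall H : groupClosed G,
     sofic_action R (lcoset_action H) ->
     exists N : normalGroupClosed G,
       {subset N <= H} /\ sofic_group R (lcosets N))
  /\ (sofic_action R (ltrans_action G) -> sofic_group R G).
Proof.
split=> [H sof|sof F eps eps0]; last first.
  have [A [phi [A0 phi1 phiM dphi]]] := sofic_action_displace 1%g F sof eps0.
  exists A, phi; split=> // g gF g1; apply: dphi => //=.
  by rewrite mulg1; apply/eqP.
(* [B] records the lower bound off [H] along with the maps, so that it is available for functions
   close to the limit. *)
pose B (F : {fset G}) (eps : R) : set (G -> R) := fun f =>
  exists (A : finType) (phi : G -> {perm A}),
    [/\ (0 < #|A|)%N /\ unital phi, multiplicative_upto phi F eps,
        forall g, g \in F -> g \notin H -> 1 - eps < f g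
      & f = fun g => hamming R 1%g (phi g)].
have [|F eps f|F F' eps eps' FF' le_eps f|l lB] := @finite_approx_limit R G B.
- move=> F eps eps0.
  have [A [phi [A0 phi1 phiM dphi]]] :=
    sofic_action_displace (\pi_(lcosets H)%qT 1%g) F sof eps0.
  exists (fun g => hamming R 1%g (phi g)), A, phi; split=> // g gF gH.
  apply: dphi => //=; rewrite lcoset_actE mulg1.
  move=> /esym/(@eqquotP _ _ (lcosets H)).
  by rewrite /= /lcoset_rel invg1 mul1g (negbTE gH).
- by move=> [A [phi [_ _ _ ->]]] x; rewrite hamming_ge0 hamming_le1.
- move=> [A [phi [A0 phiM dphi fE]]]; exists A, phi; split=> //.
    by move=> g h /FF' gF /FF' hF; apply: lt_le_trans (phiM g h gF hF) le_eps.
  by move=> g /FF' gF gH; have := dphi g gF gH; lra.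
have lP (F : {fset G}) (eps : R) : 0 < eps ->
    exists (A : finType) (phi : G -> {perm A}),
    [/\ (0 < #|A|)%N, unital phi, multiplicative_upto phi F eps
      & forall g, g \in F -> `|hamming R 1%g (phi g) - l g| < eps].
  move=> /(lB F)[f [A [phi [[A0 phi1] phiM _ ->]]] dl].
  by exists A, phi.
have [N NE] := limit_kernel lP.
exists N; split; last exact: limit_kernel_sofic lP _ NE.
move=> g; rewrite NE => /eqP lg0; apply/negPn/negP => gH.
(* With precision 1/2, an element outside [H] with [l g = 0] would need both [f g > 1/2] and
   [f g < 1/2]. *)
have half0 : 0 < 2^-1 :> R by lra.
have [f [A [phi [_ _ dphi _]]] dl] := lB [fset g]%fset _ half0.
have := dl g (fset11 g); have := dphi g (fset11 g) gH.
by rewrite lg0 subr0 => fg /(le_lt_trans (ler_norm _)); lra.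
Qed.
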